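(* Let $p\ge 2$, $a>b>0$, $x=(a-b)/(a+b)$ and $A=(a+b)/2$. Then, all means being evaluated at $(a,b)$, $$A\,\tilde{L}_{2p}\ge\tilde{T}_p\,\tilde{L}_p$$ and $$\frac{A^2}{\tilde{T}_p\,\tilde{L}_p}-\frac{A}{\tilde{L}_{2p}}\le\frac{x^{2p}}{4(1-x^{2p})}.$$
   Context: For $p>1$ and $x\in(0,1)$ define $$\arctan_p(x)=\int_0^x(1+t^p)^{-1}\,dt,\quad \mathrm{arctanh}_p(x)=\int_0^x(1-t^p)^{-1}\,dt.$$ For $p\ge 2$ and $a>b>0$ define $$\tilde{T}_p(a,b)=\frac{a-b}{2\arctan_p\left(\frac{a-b}{a+b}\right)},\quad \tilde{L}_p(a,b)=\frac{a-b}{2\,\mathrm{arctanh}_p\left(\frac{a-b}{a+b}\right)}.$$ *)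

(* Defs.v *)
From HB Require Import structures.
From mathcomp Require Import all_boot all_order all_algebra.
From mathcomp Require Import all_classical all_reals all_analysis.

Set Implicit Arguments.
Unset Strict Implicit.
Unset Printing Implicit Defensive.

Import Order.TTheory GRing.Theory Num.Theory.
Import numFieldNormedType.Exports.

Local Open Scope classical_set_scope.
Local Open Scope ring_scope.

(* For p > 1 and 0 < x < 1 both integrands are continuous on [0, x] (as
   0 `^ p = 0), so the Lebesgue integrals below are the Riemann integrals. *)
Definition arctanp (R : realType) (p x : R) : R :=
  \int[lebesgue_measure]_(t in `[0, x]) (1 + t `^ p)^-1.

Definition arctanhp (R : realType) (p x : R) : R :=
  \int[lebesgue_measure]_(t in `[0, x]) (1 - t `^ p)^-1.

Definition meanT (R : realType) (p a b : R) : R :=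
  (a - b) / (2 * arctanp p ((a - b) / (a + b))).

Definition meanL (R : realType) (p a b : R) : R :=
  (a - b) / (2 * arctanhp p ((a - b) / (a + b))).

(* Main.v *)
Require Import Defs.
From HB Require Import structures.
From mathcomp Require Import all_boot all_order all_algebra.
From mathcomp Require Import all_classical all_reals all_analysis.
From mathcomp Require Import measurable_realfun ring lra.

Import Order.TTheory GRing.Theory Num.Theory.
Import numFieldNormedType.Exports.

Local Open Scope ring_scope.

(** Put [w = 1 / (1 + X)] with [X = x ^ p < 1], and write [F] and [G] for the
    averages over [0, x] of [f(t) = 1 / (1 + t^p)] and [g(t) = 1 / (1 - t^p)].
    Then [A / T_p = F] and [A / L_p = G].  Since

      [1 / (1 - s^2) = (1 / (1 + s) + 1 / (1 - s)) / 2],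

    the average attached to [L_2p] is [A / L_2p = (F + G) / 2], so both claims
    concern the single quantity [F G - (F + G) / 2]: it is nonnegative, and at
    most [X^2 / (4 (1 - X^2))].

    Moreover [1 / f + 1 / g = 2], that is [g = phi(f)] with
    [phi(u) = u / (2 u - 1)] convex on [u > 1/2], and [f] takes its values in
    [[w, 1]], to the right of [1/2].  Convexity places [phi] between a tangent
    and a chord, and averaging these two affine bounds gives the two claims:

    - the tangent at [F] (Jensen) gives [G >= phi(F)], which rearranges to
      [F G >= (F + G) / 2];

    - the chord over [[w, 1]] gives [G <= 1 + r (1 - F)] with
      [r = (1 + X) / (1 - X)], whence
      [F G - (F + G) / 2 <= r (1 - F) (F - w) <= r (1 - w)^2 / 4], and the last
      bound is exactly [X^2 / (4 (1 - X^2))].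

    The averaging argument works for any measurable [h], in place of [t^p],
    with values in [[0, X]] on a set of finite measure [m > 0]; it is carried
    out in that generality in [Rintegral_conj_ge] and [Rintegral_conj_le], where
    [F] and [G] denote the integrals, that is [m] times the averages. *)

Section ConjugateAverages.
Set Implicit Arguments.
Unset Strict Implicit.
Local Open Scope classical_set_scope.
Context d (T : measurableType d) (R : realType).
Variable mu : {measure set T -> \bar R}.
Variable D : set T.
Hypotheses (mD : measurable D) (muD : (mu D < +oo)%E).

(** Inversion is not continuous at [0], so measurability is obtained from that
    of the power function with exponent [-1]. *)
Lemma integrable_inv (h : T -> R) (c : R) : 0 < c -> measurable_fun D h ->
  (forall t, D t -> c <= h t) ->
  mu.-integrable D (EFin \o (fun t => (h t)^-1)).
Proof.
move=> c0 mh hc.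
have h0 t : D t -> 0 < h t by move=> /hc; exact: lt_le_trans.
apply: measurable_bounded_integrable => //.
  apply: (@eq_measurable_fun _ _ _ _ _ (fun t => h t `^ (-1))).
    by move=> t /set_mem /h0 /ltW ht; rewrite powR_inv1.
  exact: (measurableT_comp (@measurable_powR R (-1))).
exists c^-1; split; first exact: num_real.
move=> M cM t Dt; apply: le_trans (ltW cM).
by rewrite ger0_norm ?invr_ge0 ?(ltW (h0 _ Dt))// lef_pV2 ?posrE ?h0 ?hc.
Qed.

Lemma integrable_cst (u : R) : mu.-integrable D (EFin \o cst u).
Proof.
apply: measurable_bounded_integrable => //.
exists `|u|%R; split; first exact: num_real.
by move=> M uM t _; exact: ltW.
Qed.

Lemma integrable_affine (f : T -> R) (u v : R) :
  mu.-integrable D (EFin \o f) ->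
  mu.-integrable D (EFin \o (fun t => u + v * f t)).
Proof.
move=> fi.
exact: (integrableD mD (integrable_cst u) (integrableZl mD v fi)).
Qed.

Lemma Rintegral_affine (f : T -> R) (u v : R) :
  mu.-integrable D (EFin \o f) ->
  \int[mu]_(t in D) (u + v * f t) =
  u * fine (mu D) + v * \int[mu]_(t in D) f t.
Proof.
move=> fi.
rewrite (RintegralD mD (integrable_cst u) (integrableZl mD v fi)).
by rewrite Rintegral_cst// RintegralZl.
Qed.

Variables (h : T -> R) (X : R).
Hypotheses (mh : measurable_fun D h) (X1 : X < 1).
Hypothesis hX : forall t, D t -> 0 <= h t <= X.

Let m := fine (mu D).
Let F := \int[mu]_(t in D) (1 + h t)^-1.
Let G := \int[mu]_(t in D) (1 - h t)^-1.

Lemma integrable_invD : mu.-integrable D (EFin \o (fun t => (1 + h t)^-1)).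
Proof.
apply: (@integrable_inv _ 1) => //; first exact: measurable_funD.
by move=> t /hX; lra.
Qed.

Lemma integrable_invB : mu.-integrable D (EFin \o (fun t => (1 - h t)^-1)).
Proof.
apply: (@integrable_inv _ (1 - X)); first by rewrite subr_gt0.
  exact: measurable_funB.
by move=> t /hX; lra.
Qed.

(** Partial fractions: this is what expresses the mean of exponent [2 p]
    through those of exponent [p]. *)
Lemma Rintegral_invB_sqr :
  \int[mu]_(t in D) (1 - h t ^+ 2)^-1 = (F + G) / 2.
Proof.
rewrite mulrC -RintegralD ?integrable_invD ?integrable_invB//.
rewrite -RintegralZl//; last exact: integrableD integrable_invD integrable_invB.
apply: eq_Rintegral => t /set_mem /hX ht.
have X1' : 0 < 1 - X by rewrite subr_gt0.
by field; rewrite !gt_eqF//; nra.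
Qed.

(** The average of [1 / (1 + h)] stays to the right of the pole [1/2] of
    [phi(u) = u / (2 u - 1)]. *)
Lemma Rintegral_invD_gt_half : 0 <= X -> 0 < m -> m < 2 * F.
Proof.
move=> X0 m0.
have : (1 + X)^-1 * m <= F.
  rewrite -[_ * m]addr0 -(mul0r F) -(Rintegral_affine _ _ integrable_invD).
  apply: le_Rintegral => //.
  - exact: integrable_affine _ _ integrable_invD.
  - exact: integrable_invD.
  - move=> t /hX ht; rewrite mul0r addr0 lef_pV2 ?posrE; lra.
have : 2^-1 < (1 + X)^-1.
  have X1' : 0 < 1 - X by rewrite subr_gt0.
  by rewrite ltf_pV2 ?posrE; lra.
by nra.
Qed.

(** Tangent bound at the average [F / m]: with [c = 2 F / m - 1] and
    [v = 2 / (1 + s) - 1 = (1 - s) / (1 + s)], the gap between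
    [1 / (1 - s)] and its tangent in the variable [1 / (1 + s)] is
    [(v - c)^2 / (2 c^2 v)]. *)
Lemma Rintegral_conj_ge : 0 <= X -> 0 < m -> m * (F + G) / 2 <= F * G.
Proof.
move=> X0 m0; have mF := Rintegral_invD_gt_half X0 m0.
pose c := 2 * F / m - 1.
have c0 : 0 < c by rewrite subr_gt0 ltr_pdivlMr ?mul1r.
pose u := 2^-1 + c^-1 + (2 * c ^+ 2)^-1.
have : u * m + (- (c ^+ 2)^-1) * F <= G.
  rewrite -(Rintegral_affine _ _ integrable_invD).
  apply: le_Rintegral => //.
  - exact: integrable_affine _ _ integrable_invD.
  - exact: integrable_invB.
  - move=> t /hX ht; have X1' : 0 < 1 - X by rewrite subr_gt0.
    rewrite -subr_ge0.
    set s := h t in ht *; pose v := (1 - s) / (1 + s).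
    have v0 : 0 < v by rewrite divr_gt0; lra.
    rewrite [leRHS](_ : _ = (v - c) ^+ 2 / (2 * c ^+ 2 * v)).
      apply: divr_ge0; first exact: sqr_ge0.
      by rewrite ltW// mulr_gt0// mulr_gt0// exprn_gt0.
    by rewrite /u /v; field; rewrite !gt_eqF//; lra.
have -> : u * m + (- (c ^+ 2)^-1) * F = m * F / (2 * F - m).
  have -> : F = m * (c + 1) / 2 by rewrite /c; field; rewrite gt_eqF.
  by rewrite /u; field; rewrite !gt_eqF//; nra.
by move=> FG; rewrite ler_pdivrMr ?subr_gt0// in FG; lra.
Qed.

(** Chord bound: [1 / (1 - s) <= 1 + r (1 - 1 / (1 + s))] for [s] in [[0, X]],
    with equality at both ends. *)
Lemma Rintegral_conj_le : 0 <= X -> 0 < m ->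
  F * G <= m * (F + G) / 2 + m ^+ 2 * (X ^+ 2 / (4 * (1 - X ^+ 2))).
Proof.
move=> X0 m0; have mF := Rintegral_invD_gt_half X0 m0.
pose r := (1 + X) / (1 - X).
have X1' : 0 < 1 - X by rewrite subr_gt0.
have r0 : 0 < r by rewrite divr_gt0; lra.
have : G <= (1 + r) * m + (- r) * F.
  rewrite -(Rintegral_affine _ _ integrable_invD).
  apply: le_Rintegral => //.
  - exact: integrable_invB.
  - exact: integrable_affine _ _ integrable_invD.
  - move=> t /hX ht; rewrite -subr_ge0.
    set s := h t in ht *.
    rewrite [leRHS](_ : _ = 2 * s * (X - s) / ((1 - X) * (1 - s ^+ 2))).
      by rewrite divr_ge0 ?mulr_ge0//; nra.
    by rewrite /r; field; rewrite !gt_eqF//; nra.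
move=> GF; have {GF} :
    G * (F - m / 2) <= ((1 + r) * m + (- r) * F) * (F - m / 2).
  by rewrite ler_wpM2r//; lra.
(* the quadratic [(m - F) (F - m / (1 + X))] peaks at the midpoint of its
   roots *)
have : 0 <= r * (F - m * (2 + X) / (2 * (1 + X))) ^+ 2.
  by rewrite mulr_ge0 ?sqr_ge0// ltW.
have -> : r * (F - m * (2 + X) / (2 * (1 + X))) ^+ 2 =
  m ^+ 2 * (X ^+ 2 / (4 * (1 - X ^+ 2))) + m * F / 2 -
  ((1 + r) * m + (- r) * F) * (F - m / 2).
  by rewrite /r; field; rewrite !gt_eqF//; nra.
lra.
Qed.

End ConjugateAverages.

Theorem theorem2p10 (R : realType) (p a b : R)
    (hp : 2 <= p) (hb : 0 < b) (hab : b < a) :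
  let x := (a - b) / (a + b) in
  let A := (a + b) / 2 in
  A * meanL (2 * p) a b >= meanT p a b * meanL p a b /\
  A ^+ 2 / (meanT p a b * meanL p a b) - A / meanL (2 * p) a b
    <= x `^ (2 * p) / (4 * (1 - x `^ (2 * p))).
Proof.
move=> x A.
have ab0 : 0 < a + b by lra.
have x0 : 0 < x by rewrite divr_gt0; lra.
have x1 : x < 1 by rewrite ltr_pdivrMr; lra.
have A0 : 0 < A by rewrite divr_gt0.
have abE : a - b = 2 * (A * x) by rewrite /A /x; field; rewrite gt_eqF.
rewrite /meanT /meanL -/x abE.
pose D : set R := `[0, x]%classic.
have mD : measurable D by exact: measurable_itv.
have muE : fine (lebesgue_measure D) = x.
  by rewrite /D lebesgue_measure_itv/= lte_fin x0 -EFinB subr0.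
have muD : (lebesgue_measure D < +oo)%E.
  by rewrite /D lebesgue_measure_itv/= lte_fin x0 -EFinB ltry.
have sqE t : t `^ (2 * p) = (t `^ p) ^+ 2.
  by rewrite mulrC powRrM powR_mulrn// powR_ge0.
pose X := x `^ p.
have X0 : 0 <= X by exact: powR_ge0.
have X1 : X < 1.
  have <- : 1 `^ p = 1 :> R by rewrite powR1.
  by rewrite gt0_ltr_powR ?nnegrE//; lra.
have hX t : D t -> 0 <= t `^ p <= X.
  rewrite /D /= in_itv/= => /andP[t0 tx].
  by rewrite powR_ge0 ge0_ler_powR ?nnegrE//; lra.
have mh : measurable_fun D (fun t : R => t `^ p) by exact: measurable_funTS.
have m0 : 0 < fine (lebesgue_measure D) by rewrite muE.
have Fm := Rintegral_invD_gt_half (mu := lebesgue_measure) mD muD mh X1 hX X0 m0.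
have ge := Rintegral_conj_ge (mu := lebesgue_measure) mD muD mh X1 hX X0 m0.
have le := Rintegral_conj_le (mu := lebesgue_measure) mD muD mh X1 hX X0 m0.
have LE : arctanhp (2 * p) x = (arctanp p x + arctanhp p x) / 2.
  rewrite -(Rintegral_invB_sqr (mu := lebesgue_measure) mD muD mh X1 hX).
  by apply: eq_Rintegral => t _; rewrite sqE.
rewrite muE -/(arctanp p x) -/(arctanhp p x) in Fm ge le.
rewrite LE sqE -/X.
set F := arctanp p x in Fm ge le *; set G := arctanhp p x in ge le *.
have F0 : 0 < F by lra.
have G0 : 0 < G by nra.
split.
  rewrite -subr_ge0.
  rewrite [leRHS](_ : _ =
      2 * A ^+ 2 * x * (F * G - x * (F + G) / 2) / (F * G * (F + G))).
    apply: divr_ge0; last by rewrite ltW// !mulr_gt0 ?addr_gt0.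
    by rewrite mulr_ge0 ?subr_ge0// mulr_ge0 ?(ltW x0)// mulr_ge0 ?sqr_ge0.
  by field; rewrite !gt_eqF//; lra.
rewrite [leLHS](_ : _ = (F * G - x * (F + G) / 2) / x ^+ 2).
  by rewrite ler_pdivrMr ?exprn_gt0//; lra.
by field; rewrite !gt_eqF//; lra.
Qed.
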